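(* Let $p_1(x)$ and $p_2(x)$ be polynomials of degree $m-1$ and $n-1$ respectively, each of the form $(x+1)q(x)$ with $q(x)$ a polynomial all of whose coefficients are strictly positive integers, which define real quadratic cyclic sequences of orders $M$ and $N$ respectively deriving from a common fundamental increment $y$. Then there exists a real quadratic cyclic sequence of order $M+N$ with defining polynomial $p(x)=p_1(x)+x^kp_2(x)$, where $0\le k\le m$, obtained by concatenation of two real quadratic cyclic sequences with defining polynomials $p_1(x)$ and $p_2(x)$ respectively.
   Context: A *quadratic cyclic sequence (QCS) of order $N\ge2$* is a function $\phi:\mathbb{Z}/N\mathbb{Z}\to\mathbb{C}$ such that for some real constant $\gamma$, for all $j\in\mathbb{Z}/N\mathbb{Z}$, $\frac{\gamma}{2}(2\phi(j)-\phi(j-1)-\phi(j+1))^2=(\phi(j)-\phi(j-1))^2+(\phi(j)-\phi(j+1))^2$. The equation is invariant under the normalizations $\phi\mapsto a\phi+b$ ($a,b\in\mathbb{C}$, $a\neq 0$) and $\phi\mapsto\overline{\phi}$, and under cyclic permutation and order reversal. A QCS is *real* if every term is real under some normalization. *Defining polynomial and fundamental increment.* Let $p(x)=(x+1)q(x)=\sum_{k=0}^{n-1}b_kx^k$ with $q$ of degree $n-2$ ($n\ge2$) having all coefficients strictly positive integers, let $y$ be a real root of $p$ (necessarily $y<0$), and let $N=\sum_kb_k$. A real QCS $(x_0,\ldots,x_{N-1})$ has defining polynomial $p$ and fundamental increment $y$ if, up to multiplication by a nonzero constant, its increments $x_{j+1}-x_j$ are taken from $\{1,y,\ldots,y^{n-1}\}$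 in such a way that each $y^k$ occurs precisely $b_k$ times and any two (cyclically) adjacent increments have powers that differ by precisely one. ''Common fundamental increment'' means that the same $y$ is a root of both $p_1$ and $p_2$ and is used for both sequences (so they have the same $\gamma$). *Concatenation.* Given two QCS with common $\gamma$, put them by normalization, cyclic permutation and order reversal into forms $(x_0,\ldots,x_{M-1})$ and $(z_0,\ldots,z_{N-1})$ sharing a pair of successive terms, $x_0=z_0$ and $x_1=z_1$; their concatenation is the cyclic sequence $(x_0,x_1,\ldots,x_{M-1},z_0,z_1,\ldots,z_{N-1})$ of order $M+N$, considered up to cyclic permutation.
   Formalization: The range 0 ≤ k ≤ m is corrected to 0 ≤ k ≤ m−1: for k = m the quotient of p by x+1 has a zero coefficient, so p is not a defining polynomial (e.g. p1 = p2 = 1+x, k = 2 gives 1+x+x²+x³, for which no sequence exists). *)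

(* Defs.v *)
From mathcomp Require Import all_boot all_order all_algebra.
From mathcomp Require Import complex reals.

Set Implicit Arguments.
Unset Strict Implicit.
Unset Printing Implicit Defensive.

Import Order.TTheory GRing.Theory Num.Theory.

Local Open Scope ring_scope.
Local Open Scope complex_scope.

(* Cyclic sequences of order N are functions on 'Z_N.  As
   'Z_0 and 'Z_1 are both Z/2Z in MathComp, 1 < N is part of the definition
   of a quadratic cyclic sequence. *)

Definition QCS_with (R : realType) (N : nat) (gamma : R) (phi : 'Z_N -> R[i])
    : Prop :=
  (1 < N)%N /\
  forall j : 'Z_N,
    (gamma / 2%:R)%:C * (2%:R * phi j - phi (j - 1) - phi (j + 1)) ^+ 2
    = (phi j - phi (j - 1)) ^+ 2 + (phi j - phi (j + 1)) ^+ 2.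

Definition is_QCS (R : realType) (N : nat) (phi : 'Z_N -> R[i]) : Prop :=
  exists gamma : R, QCS_with gamma phi.

(* The maps obtained by composing affine maps z |-> a z + b (a != 0) and
   complex conjugation. *)
Definition normalization (R : realType) (f : R[i] -> R[i]) : Prop :=
  exists a b : R[i],
    a != 0 /\
    ((forall z, f z = a * z + b) \/ (forall z, f z = a * conjc z + b)).

Definition is_real_QCS (R : realType) (N : nat) (phi : 'Z_N -> R[i]) : Prop :=
  is_QCS phi /\
  exists f : R[i] -> R[i],
    normalization f /\ forall j, exists x : R, f (phi j) = x%:C.

Definition defining_form (p : {poly int}) : Prop :=
  exists q : {poly int},
    [/\ q != 0,
        forall k : nat, (k < size q)%N -> 0 < q`_k
      & p = ('X + 1) * q].

(* The map e records which power of y each increment is: powers are compared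
   as exponents, since distinct powers of y may coincide when y = -1. *)
Definition has_defining_poly (R : realType) (N : nat) (phi : 'Z_N -> R[i])
    (p : {poly int}) (y : R) : Prop :=
  [/\ defining_form p,
      root (map_poly intr p) y,
      N%:Z = \sum_(k < size p) p`_k,
      is_real_QCS phi
    & exists (c : R[i]) (e : 'Z_N -> 'I_(size p)),
      [/\ c != 0,
          forall j, phi (j + 1) - phi j = c * (y ^+ e j)%:C,
          forall k : 'I_(size p), #|[set j | e j == k]|%:Z = p`_k
        & forall j, (e (j + 1) = (e j).+1 :> nat)
                    \/ (e j = (e (j + 1)).+1 :> nat)]].

(* psi is obtained from phi by normalization, cyclic permutation and
   (if r = true) order reversal. *)
Definition form_of (R : realType) (N : nat) (phi psi : 'Z_N -> R[i]) : Prop :=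
  exists (f : R[i] -> R[i]) (s : 'Z_N) (r : bool),
    normalization f /\
    forall j, psi j = f (phi (if r then s - j else s + j)).

Definition juxtapose (R : realType) (M N : nat)
    (x : 'Z_M -> R[i]) (z : 'Z_N -> R[i]) : 'Z_(M + N) -> R[i] :=
  fun j => if (j < M)%N then x (j : nat)%:R else z (j - M)%N%:R.

Definition is_concatenation (R : realType) (M N : nat)
    (phi1 : 'Z_M -> R[i]) (phi2 : 'Z_N -> R[i])
    (phi : 'Z_(M + N) -> R[i]) : Prop :=
  (exists gamma : R, QCS_with gamma phi1 /\ QCS_with gamma phi2) /\
  exists (x : 'Z_M -> R[i]) (z : 'Z_N -> R[i]) (s : 'Z_(M + N)),
    [/\ form_of phi1 x,
        form_of phi2 z,
        x 0 = z 0 /\ x 1 = z 1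
      & forall j, phi (s + j) = juxtapose x z j].

(* Main.v *)
Require Import Defs.
From mathcomp Require Import all_boot all_order all_algebra.
From mathcomp Require Import complex reals.
From mathcomp Require Import ring.

Import Order.TTheory GRing.Theory Num.Theory.

(** Up to the choice of starting value, a real quadratic cyclic sequence with
    fundamental increment [y] is a closed walk on exponents: the increment at
    [j] is [c * y ^ e j], and [e] moves by exactly one at each step.  For two
    neighbouring increments of ratio [y] the quadratic equation reads
    [gamma / 2 * (1 - y)^2 = 1 + y^2], so the constant [gamma] is a function of
    [y] alone, and every such walk is quadratic with this same [gamma]
    ([increment_walk_QCS]).  This needs [y != 1]; in fact [y < 0], because the
    defining polynomial is positive on the nonnegative reals.  All increments
    being real multiples of [c], the sequence is real as well, so that having
    a defining polynomial amounts to having a walk with prescribed visit counts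
    ([defining_poly_walk], [increment_walk_defining]).

    The theorem then becomes a splicing of closed walks.  The first walk takes
    every exponent up to the degree of [p1], hence the exponent [k] somewhere,
    and the second takes the exponent [0].  Rotate both to start there and
    rescale the second sequence by an affine map so that its increments use the
    exponents [k + e2] with the constant [c] of the first, and so that the two
    starting terms agree.  Since [y ^ k != 0] the rescaling is invertible.  The
    first increments agree too, so the second terms agree.  Traversing the two
    loops one after the other gives the concatenation: because both loops start
    at the same term and the same exponent, each of its steps is a step of one
    of the loops ([juxt_step]), and visit counts add up to the coefficients of
    [p1 + 'X^k * p2] ([increment_walk_juxt]).  Finally [k <= deg p1] ensures
    that the quotient of the sum by ['X + 1] has no gap in its coefficients
    ([defining_form_add]). *)

Local Open Scope ring_scope.

Section Concatenation.

Set Implicit Arguments.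
Unset Strict Implicit.
Unset Printing Implicit Defensive.
Local Open Scope complex_scope.

(** * Polynomials of defining form *)

Lemma coef_X1M (q : {poly int}) k :
  (('X + 1) * q)`_k = (if k == 0%N then 0 else q`_k.-1) + q`_k.
Proof. by rewrite mulrDl mul1r coefD coefXM. Qed.

Lemma positive_coef_ge0 (q : {poly int}) :
  (forall k, (k < size q)%N -> 0 < q`_k) -> forall k, 0 <= q`_k.
Proof.
move=> q_gt0 k; case: (ltnP k (size q)) => [/q_gt0/ltW //|le_qk].
by rewrite nth_default.
Qed.

Lemma size_X1M (q : {poly int}) : q != 0 -> size (('X + 1) * q) = (size q).+1.
Proof.
by move=> q0; rewrite mulrC -polyC1 size_Mmonic ?monicXaddC // size_XaddC addn2.
Qed.

Lemma defining_form_size_gt0 (p : {poly int}) :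
  defining_form p -> (0 < size p)%N.
Proof. by case=> q [q0 _ ->]; rewrite size_X1M. Qed.

(** Each coefficient of [('X + 1) * q] is a sum of two neighbouring coefficients
    of [q], of which at least one is in range. *)
Lemma defining_form_coef_gt0 (p : {poly int}) k :
  defining_form p -> (k < size p)%N -> 0 < p`_k.
Proof.
case=> q [q0 q_gt0 ->]; rewrite size_X1M // ltnS coef_X1M => le_kq.
have q_ge0 := positive_coef_ge0 q_gt0.
case: (ltnP k (size q)) => [lt_kq | le_qk].
  by apply: ltr_wpDl; [case: ifP | exact: q_gt0].
have q_size : (0 < size q)%N by rewrite size_poly_gt0.
have -> : (k == 0)%N = false by apply/negbTE; rewrite -lt0n (leq_trans q_size).
apply: ltr_wpDr => //; apply: q_gt0.
by rewrite prednK // (leq_trans q_size).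
Qed.

(** With [p1 = ('X + 1) * q1] and [p2 = ('X + 1) * q2], the quotient of the sum
    is [q1 + 'X^k * q2]; the bound on [k] says that the shifted copy of [q2]
    starts no later than where [q1] ends. *)
Lemma defining_form_add (p1 p2 : {poly int}) k :
  defining_form p1 -> defining_form p2 -> (k < size p1)%N ->
  defining_form (p1 + 'X^k * p2).
Proof.
case=> q1 [q10 q1_gt0 ->] [q2 [q20 q2_gt0 ->]].
rewrite size_X1M // ltnS => le_kq1.
have q1_ge0 := positive_coef_ge0 q1_gt0.
have q2_ge0 := positive_coef_ge0 q2_gt0.
have coefE i : (q1 + 'X^k * q2)`_i
    = q1`_i + (if (i < k)%N then 0 else q2`_(i - k)).
  by rewrite coefD coefXnM.
exists (q1 + 'X^k * q2); split; last by rewrite mulrDr mulrCA.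
  have q1_size : (0 < size q1)%N by rewrite size_poly_gt0.
  apply/eqP => /(congr1 (fun q : {poly int} => q`_0)) /eqP.
  rewrite coefE coef0 gt_eqF //; apply: ltr_wpDr; last exact: q1_gt0.
  by case: ifP.
move=> i lt_i; rewrite coefE.
case: (ltnP i (size q1)) => [lt_iq1 | le_q1i].
  by apply: ltr_wpDr; [case: ifP | exact: q1_gt0].
have le_ki := leq_trans le_kq1 le_q1i.
rewrite (ltnNge i k) le_ki /=; apply: ltr_wpDl => //; apply: q2_gt0.
rewrite ltn_subLR //.
have := leq_trans lt_i (size_polyD _ _).
by rewrite leq_max ltnNge le_q1i /= mulrC size_mulXn // addnC.
Qed.

Variable R : realType.

Lemma defining_form_root_lt0 (p : {poly int}) (y : R) :
  defining_form p -> root (map_poly intr p) y -> y < 0.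
Proof.
move=> form_p; apply: contraLR; rewrite -leNgt => y_ge0.
have p_size := defining_form_size_gt0 form_p.
rewrite /root horner_coef size_map_poly_id0; last first.
  by rewrite intr_eq0 lead_coef_eq0 -size_poly_gt0.
have p_gt0 := @defining_form_coef_gt0 _ _ form_p.
case def_s: (size p) p_size p_gt0 => [//|s] _ p_gt0.
rewrite big_ord_recl gt_eqF // ltr_wpDr ?sumr_ge0 // => [i _|].
  by rewrite coef_map mulr_ge0 ?exprn_ge0 // ler0z ltW // p_gt0 // ltn_ord.
by rewrite coef_map expr0 mulr1 ltr0z p_gt0.
Qed.

(** * Increment walks *)

(** The exponents are natural numbers, not elements of ['I_(size p)], so that
    walks for different polynomials can be compared and shifted.  No bound is
    lost: an exponent that occurs has a nonzero coefficient. *)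
Definition increment_walk N (phi : 'Z_N -> R[i]) (p : {poly int}) (y : R)
    (c : R[i]) (e : 'Z_N -> nat) : Prop :=
  [/\ forall j, phi (j + 1) - phi j = c * (y ^+ e j)%:C,
      forall k : nat, #|[set j | e j == k]|%:Z = p`_k
    & forall j, e (j + 1) = (e j).+1 \/ e j = (e (j + 1)).+1].

Lemma defining_poly_walk N (phi : 'Z_N -> R[i]) p (y : R) :
  has_defining_poly phi p y ->
  exists c e, c != 0 /\ increment_walk phi p y c e.
Proof.
case=> _ _ _ _ [c [e [c0 inc cnt step]]].
exists c, (fun j => e j : nat); split=> //; split=> // k.
case: (ltnP k (size p)) => [lt_kp | le_pk].
  by rewrite -(cnt (Ordinal lt_kp)).
rewrite nth_default //; congr Posz; apply: eq_card0 => j.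
by rewrite !inE ltn_eqF // (leq_trans (ltn_ord _)).
Qed.

(** Neighbouring increments have the form [C] and [y * C] in some order, and
    the quadratic equation is homogeneous in [C] and symmetric in the two. *)
Lemma increment_walk_QCS N (phi : 'Z_N -> R[i]) p (y : R) c e :
  (1 < N)%N -> y != 1 -> increment_walk phi p y c e ->
  QCS_with (2%:R * (1 + y ^+ 2) / (1 - y) ^+ 2) phi.
Proof.
move=> N_gt1 y1 [inc _ step]; split=> // j.
have := inc j; have := inc (j - 1); have := step (j - 1); rewrite subrK.
set a := _ * _; set b := _ * _ => ste ea eb.
have -> : 2%:R * phi j - phi (j - 1) - phi (j + 1) = a - b.
  by rewrite -ea -eb; ring.
have -> : phi j - phi (j + 1) = - b by rewrite -eb opprB.
rewrite ea sqrrN.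
have y1' : (1 - y%:C) != 0.
  by rewrite -(rmorph1 (real_complex R)) -rmorphB fmorph_eq0 subr_eq0 eq_sym.
have -> : (2%:R * (1 + y ^+ 2) / (1 - y) ^+ 2 / 2%:R)%:C
    = (1 + y%:C ^+ 2) / (1 - y%:C) ^+ 2.
  rewrite [X in X%:C](_ : _ = (1 + y ^+ 2) / (1 - y) ^+ 2).
    by rewrite fmorph_div !(rmorphXn, rmorphD, rmorphN, rmorph1).
  by field; rewrite subr_eq0 eq_sym.
by case: ste => ste; rewrite /a /b ste [y ^+ _.+1]exprS rmorphM /=; field.
Qed.

(** The quadratic equation and reality follow from the walk: the former holds
    with the [gamma] determined by [y], and dividing the displacement from
    [phi 0] by [c] makes every term real. *)
Lemma increment_walk_defining N (phi : 'Z_N -> R[i]) p (y : R) c e :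
  (1 < N)%N -> defining_form p -> root (map_poly intr p) y -> c != 0 ->
  increment_walk phi p y c e -> has_defining_poly phi p y.
Proof.
move=> N_gt1 form_p root_y c0 walk.
have y_lt0 := defining_form_root_lt0 form_p root_y.
case: (walk) => inc cnt step.
have e_lt j : (e j < size p)%N.
  rewrite ltnNge; apply/negP => le_pe; have := cnt (e j).
  rewrite nth_default // => /eqP; rewrite eqz_nat cards_eq0.
  by apply/negP/set0Pn; exists j; rewrite inE.
split=> //.
- under eq_bigr => k _ do rewrite -cnt.
  rewrite -(big_morph Posz PoszD (erefl _)); congr Posz.
  rewrite -{1}(Zp_cast N_gt1) -[LHS]card_ord -sum1_card.
  rewrite (partition_big (fun j : 'Z_N => Ordinal (e_lt j)) xpredT) //=.
  by apply: eq_bigr => k _; rewrite sum1_card; apply: eq_card => j;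
    rewrite !inE.
- split.
    exists (2%:R * (1 + y ^+ 2) / (1 - y) ^+ 2).
    apply: increment_walk_QCS walk => //.
    by rewrite lt_eqF // (lt_trans y_lt0).
  exists (fun z => c^-1 * z + - (c^-1 * phi 0)); split.
    by exists c^-1, (- (c^-1 * phi 0)); split; [rewrite invr_eq0 | left].
  move=> j; rewrite -(natr_Zp j); elim: (j : nat) => [|i [r IHr]].
    by exists 0; rewrite subrr.
  exists (r + y ^+ e i%:R); rewrite rmorphD /= -IHr -natr1.
  have /eqP := inc i%:R; rewrite subr_eq => /eqP ->.
  by rewrite mulrDr mulKf // -addrA addrC.
exists c, (fun j => Ordinal (e_lt j)); split=> // k.
by rewrite -cnt.
Qed.

(** * Moving a walk *)

Lemma increment_walk_rotate N (phi : 'Z_N -> R[i]) p (y : R) c e s :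
  increment_walk phi p y c e ->
  increment_walk (fun j => phi (s + j)) p y c (fun j => e (s + j)).
Proof.
case=> inc cnt step; split=> [j|k|j]; rewrite ?addrA //.
rewrite -cnt; congr Posz.
rewrite -[RHS](card_imset _ (addrI (- s))); apply: eq_card => j.
rewrite inE; apply/idP/imsetP => [ej | [l]].
  by exists (s + j); rewrite ?inE ?addKr.
by rewrite inE => el ->; rewrite addNKr.
Qed.

Lemma increment_walk_affine N (phi : 'Z_N -> R[i]) p (y : R) c e a b :
  increment_walk phi p y c e ->
  increment_walk (fun j => a * phi j + b) p y (a * c) e.
Proof.
case=> inc cnt step; split=> // j.
by rewrite -mulrA -inc; ring.
Qed.

Lemma increment_walk_visits N (phi : 'Z_N -> R[i]) p (y : R) c e k :
  defining_form p -> (k < size p)%N -> increment_walk phi p y c e ->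
  exists s, e s = k.
Proof.
move=> form_p lt_kp [_ cnt _].
have := defining_form_coef_gt0 form_p lt_kp; rewrite -cnt ltz_nat.
by case/card_gt0P=> s; rewrite inE => /eqP; exists s.
Qed.

(** * Splicing two cycles *)

(** The construction of [juxtapose] with values in any type, so that terms and
    exponents are concatenated by the same operation. *)
Definition juxt T M N (x : 'Z_M -> T) (z : 'Z_N -> T) : 'Z_(M + N) -> T :=
  fun j => if (j < M)%N then x (j : nat)%:R else z (j - M)%N%:R.

(** When two cyclic sequences start at the same value, the end of each lap may
    be read as a return to either starting point; hence each step of the
    concatenation is a step of one of the two cycles.  The position [i] is
    chosen before the sequences so that it serves simultaneously for the terms
    and for their exponents. *)
Lemma juxt_step M N (j : 'Z_(M + N)) : (1 < M)%N -> (1 < N)%N ->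
     (exists i, forall T (x : 'Z_M -> T) (z : 'Z_N -> T), x 0 = z 0 ->
        juxt x z j = x i /\ juxt x z (j + 1) = x (i + 1))
  \/ (exists i, forall T (x : 'Z_M -> T) (z : 'Z_N -> T), x 0 = z 0 ->
        juxt x z j = z i /\ juxt x z (j + 1) = z (i + 1)).
Proof.
move=> M1 N1.
have MN1 : (1 < M + N)%N by rewrite (leq_trans M1) // leq_addr.
have lt_j : (j < M + N)%N by rewrite -[X in (_ < X)%N](Zp_cast MN1) ltn_ord.
(* The successor wraps around only at the very last position. *)
have jS : (j + 1 : 'Z_(M + N)) = (j.+1 %% (M + N))%N :> nat.
  by rewrite -[j in LHS]natr_Zp natr1 val_Zp_nat.
case: (ltnP j M) => [lt_jM | le_Mj]; [left | right].
  exists (j : nat)%:R => T x z xz0; rewrite /juxt lt_jM; split=> //.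
  rewrite jS natr1 modn_small; last by rewrite -addn1 leq_add // ltnW.
  case: ltnP => // le_MjS; have -> : j.+1 = M by apply/eqP; rewrite eqn_leq lt_jM.
  by rewrite subnn -xz0 pchar_Zp.
exists (j - M)%N%:R => T x z xz0; rewrite /juxt ltnNge le_Mj; split=> //.
rewrite jS natr1 -subSn //.
have [jE | ne_j] := eqVneq j.+1 (M + N)%N.
  by rewrite jE modnn (ltnW M1) addKn pchar_Zp.
have lt_jS : (j.+1 < M + N)%N by rewrite ltn_neqAle ne_j.
by rewrite modn_small // ltnNge (leqW le_Mj).
Qed.

Lemma card_juxt M N (e1 : 'Z_M -> nat) (e2 : 'Z_N -> nat) k :
  (1 < M)%N -> (1 < N)%N ->
  #|[set j | juxt e1 e2 j == k]|
  = (#|[set j | e1 j == k]| + #|[set j | e2 j == k]|)%N.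
Proof.
(* For orders written [n.+2] the type ['Z_(M + N)] is convertible to
   ['I_(M + N)], as splitting the sum requires. *)
case: M e1 => [|[|M]] // e1; case: N e2 => [|[|N]] // e2 _ _.
rewrite !cardsE -!sum1_card [LHS]big_mkcond.
rewrite (@big_split_ord _ _ _ M.+2 N.+2); congr (_ + _)%N;
  rewrite [RHS]big_mkcond; apply: eq_bigr => i _.
  by rewrite !unfold_in /juxt /= ltn_ord natr_Zp.
by rewrite !unfold_in /juxt /= ltnNge leq_addr /= addKn natr_Zp.
Qed.

Lemma increment_walk_juxt M N (x : 'Z_M -> R[i]) (z : 'Z_N -> R[i]) p1 p2
    (y : R) c d k e1 e2 :
  (1 < M)%N -> (1 < N)%N ->
  increment_walk x p1 y c e1 -> increment_walk z p2 y d e2 ->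
  x 0 = z 0 -> e1 0 = (k + e2 0%R)%N -> d = c * (y ^+ k)%:C ->
  increment_walk (juxtapose x z) (p1 + 'X^k * p2) y c
    (juxt e1 (fun j => (k + e2 j)%N)).
Proof.
move=> M1 N1 [inc1 cnt1 st1] [inc2 cnt2 st2] xz0 e0 dE.
pose e2k j := (k + e2 j)%N; have {}e0 : e1 0 = e2k 0 := e0.
rewrite -/e2k; split=> [j|i|j].
- rewrite -[juxtapose x z]/(juxt x z).
  case: (juxt_step j M1 N1) => -[l Hl]; have [-> ->] := Hl _ _ _ xz0;
    have [-> _] := Hl _ _ _ e0; first exact: inc1.
  by rewrite inc2 dE /e2k exprD rmorphM mulrA.
- rewrite card_juxt // PoszD cnt1 coefD coefXnM; congr (_ + _).
  case: (ltnP i k) => [lt_ik | le_ki].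
    by apply/eqP; rewrite eqz_nat cards_eq0; apply/eqP/setP => j;
      rewrite !inE gtn_eqF // (leq_trans lt_ik) // leq_addr.
  rewrite -cnt2; congr Posz; apply: eq_card => j.
  by rewrite !inE -{1}(subnKC le_ki) eqn_add2l.
case: (juxt_step j M1 N1) => -[l Hl]; have [-> ->] := Hl _ _ _ e0.
  exact: st1.
by rewrite /e2k -!addnS; case: (st2 l) => ->; [left|right].
Qed.

Lemma normalization_affine (a b : R[i]) :
  a != 0 -> normalization (fun z => a * z + b).
Proof. by move=> a0; exists a, b; split=> //; left. Qed.

End Concatenation.

Theorem proposition15 (R : realType) (m n M N : nat) (p1 p2 : {poly int})
    (y : R)
    (deg_p1 : size p1 = m) (deg_p2 : size p2 = n)
    (form_p1 : defining_form p1) (form_p2 : defining_form p2)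
    (def_p1 : exists phi1 : 'Z_M -> R[i], has_defining_poly phi1 p1 y)
    (def_p2 : exists phi2 : 'Z_N -> R[i], has_defining_poly phi2 p2 y)
    (k : nat) (lt_km : (k < m)%N) :
  exists (phi1 : 'Z_M -> R[i]) (phi2 : 'Z_N -> R[i])
         (phi : 'Z_(M + N) -> R[i]),
    [/\ has_defining_poly phi1 p1 y,
        has_defining_poly phi2 p2 y,
        is_concatenation phi1 phi2 phi
      & has_defining_poly phi (p1 + 'X^k * p2) y].
Proof.
case: def_p1 def_p2 => [phi1 D1] [phi2 D2]; rewrite -deg_p1 in lt_km.
have [c [e1 [c0 W1]]] := defining_poly_walk D1.
have [d [e2 [d0 W2]]] := defining_poly_walk D2.
have [_ root1 _ [[g1 [M1 _]] _] _] := D1.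
have [_ root2 _ [[g2 [N1 _]] _] _] := D2.
have y_lt0 := defining_form_root_lt0 form_p1 root1.
have y1 : y != 1 by rewrite lt_eqF // (lt_trans y_lt0).
have [s1 es1] := increment_walk_visits form_p1 lt_km W1.
have [s2 es2] :=
  increment_walk_visits form_p2 (defining_form_size_gt0 form_p2) W2.
(* [a] turns the increment [d] at [s2], of exponent [0], into the increment
   [c * y ^+ k] at [s1], and [b] aligns the starting terms. *)
pose a := c * (real_complex R (y ^+ k)) / d.
have a0 : a != 0.
  rewrite !mulf_neq0 ?invr_eq0 // fmorph_eq0.
  by rewrite expf_neq0 // lt_eqF.
pose b := phi1 s1 - a * phi2 s2.
pose x j := phi1 (s1 + j); pose z j := a * phi2 (s2 + j) + b.
have Wx := increment_walk_rotate s1 W1.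
have Wz := increment_walk_affine a b (increment_walk_rotate s2 W2).
have xz0 : x 0 = z 0 by rewrite /x /z !addr0 addrC subrK.
have aE : a * d = c * real_complex R (y ^+ k) by rewrite divfK.
have e0 : e1 (s1 + 0) = (k + e2 (s2 + 0)%R)%N by rewrite !addr0 es1 es2 addn0.
have W := increment_walk_juxt M1 N1 Wx Wz xz0 e0 aE.
exists phi1, phi2, (juxtapose x z); split=> //.
- split.
    by eexists; split; [apply: increment_walk_QCS W1 | apply: increment_walk_QCS W2].
  exists x, z, 0; split.
  + exists (fun z => 1 * z + 0), s1, false; split.
      by apply: normalization_affine; rewrite oner_eq0.
    by move=> j; rewrite mul1r addr0.
  + by exists (fun z => a * z + b), s2, false; split; first exact: normalization_affine.
  + split=> //; case: Wx Wz => /(_ 0) incx _ _ [/(_ 0) incz _ _].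
    have x1 : x (0 + 1) - x 0 = z (0 + 1) - z 0.
      rewrite [LHS]incx [RHS]incz aE !addr0 es1 es2.
      by rewrite expr0 rmorph1 mulr1.
    by rewrite xz0 !add0r in x1; exact: addIr x1.
  + by move=> j; rewrite add0r.
apply: increment_walk_defining W => //.
- by rewrite (leq_trans M1) // leq_addr.
- exact: defining_form_add.
rewrite /root rmorphD rmorphM hornerD hornerM.
by rewrite (eqP root1) (eqP root2) mulr0 addr0.
Qed.
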